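(* Let $G$ be a simple graph on $n$ vertices and let $k$ be an integer with $2\le k\le n-2$. If the maximum degree $\Delta(G)\ge 5$ or the circumference $c(G)\ge 5$, then $F_k(G)$ is non-planar.
   Context: For a simple graph $G=(V,E)$ on $n$ vertices and an integer $1\le k<n$, the $k$-token graph $F_k(G)$ is the graph whose vertices are all $k$-element subsets of $V$, two such subsets $A,B$ being adjacent whenever their symmetric difference $A\triangle B$ is a pair $\{a,b\}$ with $a$ adjacent to $b$ in $G$. The circumference $c(G)$ is the maximum length of a cycle in $G$ (with $c(G)=0$ if $G$ has no cycle). *)

(* Defs.v *)
From Stdlib Require Import Reals.
From mathcomp Require Import all_boot.

Set Implicit Arguments.
Unset Strict Implicit.
Unset Printing Implicit Defensive.

Definition simple_graph (T : finType) (e : rel T) : Prop :=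
  symmetric e /\ irreflexive e.

Definition token (T : finType) (k : nat) := {A : {set T} | #|A| == k}.

Definition token_adj (T : finType) (e : rel T) (k : nat) : rel (token T k) :=
  fun A B => [exists a : T, exists b : T,
     e a b && (((val A :\: val B) :|: (val B :\: val A)) == [set a; b])].

Definition maxdeg_ge (T : finType) (e : rel T) (d : nat) : Prop :=
  exists v : T, d <= #|[set w | e v w]|.

Definition circumference_ge (T : finType) (e : rel T) (c : nat) : Prop :=
  exists s : seq T, [/\ uniq s, c <= size s & cycle e s].

(* Topological planarity: a drawing in R^2 with vertices as distinct points
   and edges as simple arcs (continuous injective images of [0,1]) joining
   their endpoints, whose interiors avoid all vertex points and meet no other
   edge. An arc is given for each ordered adjacent pair (x,y); arcs of the
   same unordered edge are not compared. *)
Definition planar (V : finType) (adj : rel V) : Prop :=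
  exists (pos : V -> R * R) (arc : V -> V -> R -> R * R),
    injective pos /\
    (forall x y, adj x y ->
       (forall t, continuity_pt (fun s => fst (arc x y s)) t /\
                  continuity_pt (fun s => snd (arc x y s)) t) /\
       arc x y R0 = pos x /\ arc x y R1 = pos y /\
       (forall s t, (Rle R0 s /\ Rle s R1) -> (Rle R0 t /\ Rle t R1) ->
          arc x y s = arc x y t -> s = t) /\
       (forall t z, (Rlt R0 t /\ Rlt t R1) -> arc x y t <> pos z)) /\
    (forall x y x' y', adj x y -> adj x' y' ->
       [set x; y] != [set x'; y'] ->
       forall s t, (Rlt R0 s /\ Rlt s R1) -> (Rlt R0 t /\ Rlt t R1) ->
       arc x y s <> arc x' y' t).

(* Main.v *)
Require Import Defs.
From Stdlib Require Import Reals Lra Ring IndefiniteDescription.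
From mathcomp Require Import all_boot.

(** In a planar drawing, orient each edge and let [P v f] be the parity of the
number of times the vector from the vertex [v] to a point running along the
edge [f] crosses the positive x-axis; let [S u v] say whether the vector from
[v] to [u] points into the upper half-plane. For disjoint edges [ab] and [cd]
the map [(s,t) |-> ab(s) - cd(t)] sends the square to the punctured plane, so its
boundary crosses the axis evenly; since opposite vectors cross the whole axis
together, this reads [P c ab + P d ab + P a cd + P b cd = S a c + S a d + S b c
+ S b d] modulo 2. Summing over all pairs of disjoint edges of K5 or K33, the
terms [P] cancel and the terms [S] leave 1. Curves are only sampled finely,
with disjoint edges at positive distance, so the boundary of the square is
handled on a grid. The argument tolerates walks instead of simple paths and
crossings of adjacent edges, so it suffices to find in the token graph
connected regions, one for each edge of K5 or K33, that are disjoint for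
disjoint edges.

Such regions come from a small graph H in G, a star with five leaves or a
5-cycle one of whose edges is replaced by a path, the tokens outside H being
fixed: a walk in the token graph of H is lifted by pushing tokens along the
long path, and a region is recognised by the positions it leaves unchanged
among the vertices of H. *)

Set Implicit Arguments.
Unset Strict Implicit.
Unset Printing Implicit Defensive.

(** * Crossing parity of sampled curves *)

Delimit Scope R_scope with Re.

Definition vsub (p q : R * R) : R * R := (p.1 - q.1, p.2 - q.2)%Re.

Definition near (d : R) (p q : R * R) : Prop :=
  (Rabs (p.1 - q.1) < d)%Re /\ (Rabs (p.2 - q.2) < d)%Re.

Definition far (d : R) (p q : R * R) : Prop :=
  (d <= Rabs (p.1 - q.1))%Re \/ (d <= Rabs (p.2 - q.2))%Re.

(* The boundary ray is included so that exactly one of [u], [-u] is upper. *)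
Definition upper (u : R * R) : bool :=
  if Rlt_dec 0 u.2 then true
  else if Req_EM_T u.2 0 then (if Rlt_dec 0 u.1 then true else false) else false.

Definition rightward (u : R * R) : bool := if Rlt_dec 0 u.1 then true else false.

(** The half of the axis is read off at the starting vector only. If steps are short compared with
    the distance from the origin, a step that changes half-plane has both ends on the same side. *)
Definition cross (u v : R * R) : bool := xorb (upper u) (upper v) && rightward u.

Ltac cases_abs :=
  repeat match goal with
  | H : context [Rabs ?x] |- _ =>
      revert H; unfold Rabs at 1; destruct (Rcase_abs x); intro H
  | |- context [Rabs ?x] => unfold Rabs at 1; destruct (Rcase_abs x)
  end.

Lemma upper_pos u : (0 < u.2)%Re -> upper u = true.
Proof. by rewrite /upper; case: Rlt_dec. Qed.

Lemma upper_neg u : (u.2 < 0)%Re -> upper u = false.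
Proof.
by rewrite /upper => ?; case: Rlt_dec => ?; [lra | case: Req_EM_T => ? //; lra].
Qed.

Lemma upper_close d u v : (Rabs (u.2 - v.2) < d)%Re -> (d <= Rabs u.2)%Re ->
  upper u = upper v.
Proof.
move=> A B; case: (Rtotal_order u.2 0) => [u0 | [u0 | u0]].
- by rewrite !upper_neg //; cases_abs; lra.
- by exfalso; move: A B; rewrite u0; cases_abs; lra.
- by rewrite !upper_pos //; cases_abs; lra.
Qed.

Lemma upper_vsubC d p q : (0 < d)%Re -> far d p q ->
  upper (vsub p q) = ~~ upper (vsub q p).
Proof.
rewrite /far /upper /vsub /= => d0 H.
by repeat (case: Rlt_dec => /= ?); repeat case: Req_EM_T => /= ? //;
  exfalso; case: H; cases_abs; lra.
Qed.

(** When the half-plane changes, the second coordinate is below [10 * d], so the first is large and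
    negation reverses its sign: exactly one of the two opposite steps crosses the positive half of
    the axis. *)
Lemma cross_vsubC d p q q' : (0 < d)%Re -> near d q q' -> far (10 * d) p q ->
  xorb (cross (vsub p q) (vsub p q')) (cross (vsub q p) (vsub q' p))
  = xorb (upper (vsub p q)) (upper (vsub p q')).
Proof.
move=> d0 [nq1 nq2] H.
have H' : far d p q' by move: H; rewrite /far => H1; cases_abs; lra.
have H0 : far d p q by move: H; rewrite /far => H1; cases_abs; lra.
have flip : upper (vsub p q) != upper (vsub p q') ->
    rightward (vsub q p) = ~~ rightward (vsub p q).
  move=> U; have {U}small : (Rabs (p.2 - q.2) < 10 * d)%Re.
    case: (Rlt_dec (Rabs (p.2 - q.2)) (10 * d)) => // big; case/eqP: U.
    by apply: (@upper_close d) => /=; cases_abs; lra.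
  move: H; rewrite /far /rightward /vsub /= => H1.
  by do 2 case: Rlt_dec => /= ? //; exfalso; case: H1; cases_abs; lra.
have E1 : upper (vsub q p) = ~~ upper (vsub p q) by rewrite (upper_vsubC d0 H0) negbK.
have E2 : upper (vsub q' p) = ~~ upper (vsub p q') by rewrite (upper_vsubC d0 H') negbK.
rewrite /cross E1 E2; move: flip.
case: (upper (vsub p q)); case: (upper (vsub p q')) => //= F;
  by rewrite (F isT); case: (rightward _).
Qed.

(** A change of sign forces the first coordinate below [3 * d], so the second is at least [10 * d]
    in absolute value and keeps its sign at all nearby pairs. *)
Lemma upper_near d p q p' q' : (0 < d)%Re -> near d p p' -> near d q q' ->
  far (10 * d) p q -> rightward (vsub p q) != rightward (vsub p' q') ->
  forall p2 q2, near (2 * d) p p2 -> near (2 * d) q q2 ->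
  upper (vsub p2 q2) = upper (vsub p q).
Proof.
rewrite /near /far /rightward /vsub /= => d0 [H1 H2] [H3 H4] H R p2 q2 [H5 H6] [H7 H8].
have {R}small : (Rabs (p.1 - q.1) < 3 * d)%Re.
  by clear -d0 H1 H3 R; move: R; (do 2 case: Rlt_dec => /= ?) => // _; cases_abs; lra.
have {}H : (10 * d <= Rabs (p.2 - q.2))%Re by lra.
apply/esym/(@upper_close (10 * d)) => //=.
by clear -d0 H6 H8; cases_abs; lra.
Qed.

Lemma near_refl d p : (0 < d)%Re -> near d p p.
Proof. by rewrite /near; do 2!rewrite Rminus_diag Rabs_R0. Qed.

Lemma near_double d p q : (0 < d)%Re -> near d p q -> near (2 * d) p q.
Proof. by move=> d0 [? ?]; split; lra. Qed.

(** If [rightward] is the same at all four corners, the [upper] value of each corner enters twice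
    and cancels. Otherwise all corners lie in one half-plane and nothing is crossed. *)
Lemma cross_square d p p' q q' : (0 < d)%Re -> near d p p' -> near d q q' ->
  far (10 * d) p q ->
  xorb (xorb (cross (vsub p q) (vsub p' q)) (cross (vsub p q') (vsub p' q')))
       (xorb (cross (vsub p q) (vsub p q')) (cross (vsub p' q) (vsub p' q')))
  = false.
Proof.
move=> d0 Np Nq F.
have R0 := near_refl _ d0.
have [p1 q1] : near (2 * d) p p' /\ near (2 * d) q q' by split; apply: near_double.
have D0 : (0 < 2 * d)%Re by lra.
have U x y : near d p x -> near d q y -> rightward (vsub p q) != rightward (vsub x y) ->
    [/\ upper (vsub p' q) = upper (vsub p q), upper (vsub p q') = upper (vsub p q)
      & upper (vsub p' q') = upper (vsub p q)].
  by move=> nx ny r; split; apply: (upper_near d0 nx ny F r) => //; apply: near_refl.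
move: (U _ _ Np (R0 q)) (U _ _ (R0 p) Nq) (U _ _ Np Nq); rewrite /cross.
case: (upper (vsub p q)); case: (upper (vsub p' q)); case: (upper (vsub p q'));
case: (upper (vsub p' q')); case: (rightward (vsub p q)); case: (rightward (vsub p' q));
case: (rightward (vsub p q')); case: (rightward (vsub p' q')) => //= A B C;
by [case: (A isT) | case: (B isT) | case: (C isT)].
Qed.

Fixpoint crossings (q p : R * R) (l : seq (R * R)) : bool :=
  if l is p' :: l' then xorb (cross (vsub p q) (vsub p' q)) (crossings q p' l')
  else false.

(** The moving point is the subtracted one, so each vector is opposite to the one used by
    [crossings p q l]. *)
Fixpoint rev_crossings (p q : R * R) (l : seq (R * R)) : bool :=
  if l is q' :: l' then xorb (cross (vsub p q) (vsub p q')) (rev_crossings p q' l')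
  else false.

Ltac case_bools :=
  repeat match goal with
  | |- context [upper ?u] => case: (upper u)
  | |- context [rightward ?u] => case: (rightward u)
  | |- context [cross ?u ?v] => case: (cross u v)
  | |- context [crossings ?q ?p ?l] => case: (crossings q p l)
  | |- context [rev_crossings ?p ?q ?l] => case: (rev_crossings p q l)
  end => //=.

Inductive trail (K : R * R -> Prop) (d : R) : R * R -> seq (R * R) -> Prop :=
| TrailNil p : K p -> trail K d p [::]
| TrailCons p p' l : K p -> near d p p' -> trail K d p' l -> trail K d p (p' :: l).

Lemma trail_cat K d p l l' :
  trail K d p l -> trail K d (last p l) l' -> trail K d p (l ++ l').
Proof. by elim=> //= {}p p' {}l Kp N _ IH T; apply: TrailCons => //; apply: IH. Qed.

Lemma trail_head K d p l : trail K d p l -> K p.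
Proof. by case. Qed.

Lemma trail_last K d p l : trail K d p l -> K (last p l).
Proof. by elim. Qed.

Lemma trail_sub (K K' : R * R -> Prop) d p l :
  (forall x, K x -> K' x) -> trail K d p l -> trail K' d p l.
Proof. by move=> S; elim=> *; [apply: TrailNil | apply: TrailCons]; auto. Qed.

(** Summing [cross_vsubC] along the trail telescopes the [upper] terms to those of its two ends. *)
Lemma rev_crossingsE (K K' : R * R -> Prop) d p q m : (0 < d)%Re ->
  (forall x y, K x -> K' y -> far (10 * d) x y) -> K p -> trail K' d q m ->
  rev_crossings p q m =
  xorb (crossings p q m) (xorb (upper (vsub p q)) (upper (vsub p (last q m)))).
Proof.
move=> d0 F Kp; elim=> [{}q _ | {}q q' {}m K'q N T IH] /=.
  by case: upper.
rewrite IH; have := cross_vsubC d0 N (F _ _ Kp K'q).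
by case_bools.
Qed.

(** The boundary of the grid of sample pairs is the sum modulo 2 of its cells, which vanish by
    [cross_square]. The outer induction adds strips along [l], the inner one cells along [m]. *)
Lemma crossings_rectangle (K K' : R * R -> Prop) d p l q m : (0 < d)%Re ->
  (forall x y, K x -> K' y -> far (10 * d) x y) ->
  trail K d p l -> trail K' d q m ->
  xorb (xorb (crossings q p l) (crossings (last q m) p l))
       (xorb (rev_crossings p q m) (rev_crossings (last p l) q m)) = false.
Proof.
move=> d0 F Tl Tm; elim: Tl => [{}p Kp | {}p p' {}l Kp Np Tl IH] /=.
  by case_bools.
have {}IH : rev_crossings (last p' l) q m =
    xorb (xorb (crossings q p' l) (crossings (last q m) p' l)) (rev_crossings p' q m).
  by move: IH; case_bools.
rewrite {}IH.
suff : xorb (xorb (cross (vsub p q) (vsub p' q))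
                  (cross (vsub p (last q m)) (vsub p' (last q m))))
            (xorb (rev_crossings p q m) (rev_crossings p' q m)) = false.
  by case_bools.
elim: Tm => [{}q K'q | {}q q' {}m K'q Nq Tm IH] /=; first by case_bools.
move: IH (cross_square d0 Np Nq (F _ _ Kp K'q)).
by case_bools.
Qed.

(** * Parity obstruction of K5 and K33 *)

Definition disjoint_edges (f g : nat * nat) : bool :=
  [&& f.1 != g.1, f.1 != g.2, f.2 != g.1 & f.2 != g.2].

(** Antisymmetry of [S] is asked only at endpoints of disjoint edges, because only such points will
    be known to lie apart in a drawing. *)
Definition obstructed (E : seq (nat * nat)) : Prop :=
  forall (P : nat -> nat * nat -> bool) (S : nat -> nat -> bool),
  (forall f g, f \in E -> g \in E -> disjoint_edges f g ->
     xorb (xorb (P g.1 f) (P g.2 f)) (xorb (P f.1 g) (P f.2 g)) =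
     xorb (xorb (S f.1 g.1) (S f.1 g.2)) (xorb (S f.2 g.1) (S f.2 g.2))) ->
  (forall f g x y, f \in E -> g \in E -> disjoint_edges f g ->
     (x == f.1) || (x == f.2) -> (y == g.1) || (y == g.2) ->
     S x y = ~~ S y x) ->
  False.

Definition K5 : seq (nat * nat) :=
  [:: (0,1); (0,2); (0,3); (0,4); (1,2); (1,3); (1,4); (2,3); (2,4); (3,4)].

Definition K33 : seq (nat * nat) :=
  [:: (0,3); (0,4); (0,5); (1,3); (1,4); (1,5); (2,3); (2,4); (2,5)].

(** Disjoint edges have distinct first endpoints, so comparing these keeps each unordered pair
    once. *)
Definition disjoint_pairs (E : seq (nat * nat)) : seq ((nat * nat) * (nat * nat)) :=
  [seq fg <- [seq (f, g) | f <- E, g <- E] | disjoint_edges fg.1 fg.2 && (fg.1.1 < fg.2.1)].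

(** A boolean test, so that each concrete use of antisymmetry is discharged by computation. *)
Definition opposed (E : seq (nat * nat)) (x y : nat) : bool :=
  has (fun fg => disjoint_edges fg.1 fg.2 &&
         (((x == fg.1.1) || (x == fg.1.2)) && ((y == fg.2.1) || (y == fg.2.2))))
    [seq (f, g) | f <- E, g <- E].

Definition defect (P : nat -> nat * nat -> bool) (S : nat -> nat -> bool)
    (fg : (nat * nat) * (nat * nat)) : bool :=
  let: (f, g) := fg in
  xorb (xorb (xorb (P g.1 f) (P g.2 f)) (xorb (P f.1 g) (P f.2 g)))
       (xorb (xorb (S f.1 g.1) (S f.1 g.2)) (xorb (S f.2 g.1) (S f.2 g.2))).

Lemma obstructed_parity E :
  (forall P S, (forall x y, opposed E x y -> S x y = xorb true (S y x)) ->
     foldr (fun fg => xorb (defect P S fg)) false (disjoint_pairs E) = true) ->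
  obstructed E.
Proof.
move=> odd P S eqn anti.
have: foldr (fun fg => xorb (defect P S fg)) false (disjoint_pairs E) = true.
  apply: odd => x y /hasP[[_ _] /allpairsP[[f g] [/= fE gE [-> ->]]]].
  by move=> /= /andP[fg /andP[xf yg]]; rewrite (anti f g).
suff: all (fun fg => defect P S fg == false) (disjoint_pairs E).
  by elim: disjoint_pairs => //= fg s IH /andP[/eqP-> /IH].
apply/allP => -[f g]; rewrite mem_filter => /andP[/andP[/= fg _]].
move=> /allpairsP[[f' g'] [/= fE gE [? ?]]]; subst f' g'.
by rewrite eqn //; case: (xorb (xorb (S _ _) _) _).
Qed.

(** Each [P v f] with [v] outside [f] occurs in two of the 15 relations, and each pair of vertices
    in six. Reordering the arguments of [S] leaves an odd number of constants. *)
Lemma obstructed_K5 : obstructed K5.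
Proof.
apply: obstructed_parity => P S anti.
have -> : disjoint_pairs K5 =
    ltac:(let s := eval vm_compute in (disjoint_pairs K5) in exact s) by vm_compute.
cbn [foldr defect fst snd].
rewrite ?(anti 1 0 isT) ?(anti 2 0 isT) ?(anti 2 1 isT) ?(anti 3 0 isT) ?(anti 3 1 isT)
  ?(anti 3 2 isT) ?(anti 4 0 isT) ?(anti 4 1 isT) ?(anti 4 2 isT) ?(anti 4 3 isT).
(* An identity over the field with two elements, with [xorb] as addition. *)
ring.
Qed.

Lemma obstructed_K33 : obstructed K33.
Proof.
apply: obstructed_parity => P S anti.
have -> : disjoint_pairs K33 =
    ltac:(let s := eval vm_compute in (disjoint_pairs K33) in exact s) by vm_compute.
cbn [foldr defect fst snd].
rewrite ?(anti 3 1 isT) ?(anti 3 2 isT) ?(anti 4 1 isT) ?(anti 4 2 isT)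
  ?(anti 4 3 isT) ?(anti 5 1 isT) ?(anti 5 2 isT) ?(anti 5 3 isT) ?(anti 5 4 isT).
ring.
Qed.

(** * Curves in the plane *)

Definition curve (f : R -> R * R) : Prop :=
  forall t, continuity_pt (fun s => (f s).1) t /\ continuity_pt (fun s => (f s).2) t.

Definition on_curve (f : R -> R * R) (p : R * R) : Prop :=
  exists2 t, (0 <= t <= 1)%Re & p = f t.

Definition taxicab (p q : R * R) : R := (Rabs (p.1 - q.1) + Rabs (p.2 - q.2))%Re.

Lemma taxicab_triangle p q r : (taxicab p q <= taxicab p r + taxicab r q)%Re.
Proof.
rewrite /taxicab.
have := Rabs_triang (p.1 - r.1) (r.1 - q.1); have := Rabs_triang (p.2 - r.2) (r.2 - q.2).
rewrite (_ : p.1 - r.1 + (r.1 - q.1) = p.1 - q.1)%Re; last by lra.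
by rewrite (_ : p.2 - r.2 + (r.2 - q.2) = p.2 - q.2)%Re; lra.
Qed.

Lemma curve_nearest (f : R -> R * R) : curve f -> forall p, exists t,
  (forall s, (0 <= s <= 1)%Re -> (taxicab p (f t) <= taxicab p (f s))%Re) /\ (0 <= t <= 1)%Re.
Proof.
move=> cf p; apply: continuity_ab_min; first lra.
move=> c _; have [c1 c2] := cf c.
apply: continuity_pt_plus.
  apply: (continuity_pt_comp (fun t => p.1 - (f t).1)%Re Rabs).
    by apply: continuity_pt_minus => //; apply: continuity_pt_const.
  by apply: Rcontinuity_abs.
apply: (continuity_pt_comp (fun t => p.2 - (f t).2)%Re Rabs).
  by apply: continuity_pt_minus => //; apply: continuity_pt_const.
by apply: Rcontinuity_abs.
Qed.

(** The distance to [g] is 1-Lipschitz, so along [f] it is continuous and attains its minimum, which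
    is positive because the curves are disjoint. *)
Lemma curves_separated (f g : R -> R * R) : curve f -> curve g ->
  (forall p, on_curve f p -> ~ on_curve g p) ->
  exists2 d, (0 < d)%Re & forall p q, on_curve f p -> on_curve g q -> far d p q.
Proof.
move=> cf cg fg.
have [near_t near_tP] := functional_choice _ (curve_nearest cg).
pose m s := taxicab (f s) (g (near_t (f s))).
have m_lip s s' : (m s <= m s' + taxicab (f s) (f s'))%Re.
  have [H1 T] := near_tP (f s); have [_ T'] := near_tP (f s').
  have := H1 _ T'; have := taxicab_triangle (f s) (g (near_t (f s'))) (f s').
  by rewrite /m; lra.
have [|c _|s0 [s0min s01]] := @continuity_ab_min m 0 1; first lra.
  have [c1 c2] := cf c => eps eps0.
  have eps2 : (eps / 2 > 0)%Re by lra.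
  have [a1 [a1p A1]] := c1 _ eps2; have [a2 [a2p A2]] := c2 _ eps2.
  exists (Rmin a1 a2); split; first by apply: Rmin_pos.
  move=> x [Dx dx].
  have {}A1 := A1 x (conj Dx (Rlt_le_trans _ _ _ dx (Rmin_l _ _))).
  have {}A2 := A2 x (conj Dx (Rlt_le_trans _ _ _ dx (Rmin_r _ _))).
  move: A1 A2 (m_lip x c) (m_lip c x); rewrite /= /R_dist /taxicab.
  rewrite (Rabs_minus_sym (f c).1) (Rabs_minus_sym (f c).2) => A1 A2 L1 L2.
  by apply: Rabs_def1; lra.
(* A taxicab distance of at least [m s0] has one of its two summands at least half of that. *)
exists (m s0 / 2)%Re.
  have [_ T] := near_tP (f s0).
  have : (0 <= m s0)%Re by apply: Rplus_le_le_0_compat; apply: Rabs_pos.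
  have : m s0 <> 0%Re; last by lra.
  move=> m0; apply: (fg (f s0)); first by exists s0.
  exists (near_t (f s0)) => //.
  move: m0; rewrite /m /taxicab => m0.
  have := Rabs_pos ((f s0).1 - (g (near_t (f s0))).1).
  have := Rabs_pos ((f s0).2 - (g (near_t (f s0))).2) => P2 P1.
  by apply: injective_projections; cases_abs; lra.
move=> _ _ [s s1 ->] [t t1 ->].
have [N _] := near_tP (f s).
have := N _ t1; have := s0min _ s1; rewrite -/(m s) /far /taxicab.
by lra.
Qed.

(** By uniform continuity, sampling at multiples of [1 / N] with [1 / N] below both coordinate
    moduli gives steps shorter than [d]. *)
Lemma curve_trail (f : R -> R * R) d : (0 < d)%Re -> curve f ->
  exists2 l, trail (on_curve f) d (f 0%Re) l & last (f 0%Re) l = f 1%Re.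
Proof.
move=> d0 cf.
have c01 := compact_P3 0 1.
have [e1 H1] := Heine _ _ c01 (fun x _ => (cf x).1) (mkposreal d d0).
have [e2 H2] := Heine _ _ c01 (fun x _ => (cf x).2) (mkposreal d d0).
have e0 : (0 < Rmin e1 e2)%Re by apply: Rmin_pos; apply: cond_pos.
have [N [Ne N0]] := archimed_cor1 _ e0.
have N0' : (0 < INR N)%Re by apply: lt_0_INR.
have unit n : n <= N -> (0 <= INR n / INR N <= 1)%Re.
  move=> /leP/le_INR nN; have := pos_INR n => n0.
  have := Rinv_0_lt_compat _ N0'; have := Rinv_r (INR N) (Rgt_not_eq _ _ N0').
  by rewrite /Rdiv; split; nra.
have step n : n < N -> near d (f (INR n / INR N)%Re) (f (INR n.+1 / INR N)%Re).
  move=> nN; have E : Rabs (INR n / INR N - INR n.+1 / INR N) = (/ INR N)%Re.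
    rewrite S_INR (_ : _ - _ = - / INR N)%Re; last by field; lra.
    by rewrite Rabs_Ropp Rabs_pos_eq //; apply/Rlt_le/Rinv_0_lt_compat.
  have [m1 m2] := (Rmin_l e1 e2, Rmin_r e1 e2).
  by split; [apply: H1 | apply: H2]; rewrite ?E; try lra; apply: unit; rewrite // ltnW.
suff H n : n <= N -> exists2 l, trail (on_curve f) d (f 0%Re) l
    & last (f 0%Re) l = f (INR n / INR N)%Re.
  have [l T L] := H N (leqnn _); exists l => //; rewrite L; congr f; field; lra.
elim: n => [_|n IH nN].
  exists [::]; last by rewrite /= /Rdiv Rmult_0_l.
  by apply: TrailNil; exists 0%Re => //; lra.
have [l T L] := IH (ltnW nN).
exists (rcons l (f (INR n.+1 / INR N)%Re)); last by rewrite last_rcons.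
rewrite -cats1; apply: trail_cat => //; rewrite L.
apply: TrailCons; [by rewrite -L; apply: trail_last T | exact: step |].
by apply: TrailNil; eexists; [apply: unit nN | reflexivity].
Qed.

Lemma finite_uniform (I : finType) (Q : I -> R -> Prop) :
  (forall i d d', (0 < d' <= d)%Re -> Q i d -> Q i d') ->
  (forall i, exists2 d, (0 < d)%Re & Q i d) -> exists2 d, (0 < d)%Re & forall i, Q i d.
Proof.
move=> mono ex.
suff [d d0 H] : exists2 d, (0 < d)%Re & forall i, i \in enum I -> Q i d.
  by exists d => // i; apply: H; rewrite mem_enum.
elim: (enum I) => [|i s [d d0 IH]]; first by exists 1%Re => //; lra.
have [d' d'0 Qi] := ex i.
have m0 : (0 < Rmin d d')%Re by apply: Rmin_pos.
exists (Rmin d d') => // j; rewrite inE => /orP[/eqP-> | /IH Qj].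
  by apply: mono Qi; split=> //; apply: Rmin_r.
by apply: mono Qj; split=> //; apply: Rmin_l.
Qed.

(** * Disjoint regions in a planar drawing *)

Definition within (V : finType) (adj : rel V) (C : pred V) : rel V :=
  [rel x y | [&& adj x y, C x & C y]].

(** A walk inside the region of [f] stands for the edge [f]. Walks of disjoint edges share no
    vertex, so all their curves are at a distance bounded below. *)
Lemma planar_regions (V : finType) (adj : rel V) (E : seq (nat * nat))
    (psi : nat -> V) (C : nat * nat -> pred V) :
  planar adj -> obstructed E ->
  (forall f, f \in E -> C f (psi f.1) /\ connect (within adj (C f)) (psi f.1) (psi f.2)) ->
  (forall f g x, f \in E -> g \in E -> disjoint_edges f g -> C f x -> ~~ C g x) ->
  False.
Proof.
move=> [pos [arc [posI [arcP arcD]]]] obsE conn disjC.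
(* A vertex counts as a degenerate edge, so that every point of a walk,
   possibly of length 0, lies on some curve. *)
pose ok (e : V * V) := (e.1 == e.2) || adj e.1 e.2.
pose cur (e : V * V) := if e.1 == e.2 then fun _ => pos e.1 else arc e.1 e.2.
have curP e : ok e -> [/\ curve (cur e), cur e 0%Re = pos e.1 & cur e 1%Re = pos e.2].
  rewrite /ok /cur; case: eqVneq => [<- _ | _ /= xy].
    by split=> // t; split; apply: continuity_pt_const.
  by have [c [a0 [a1 _]]] := arcP _ _ xy.
have cur_cases e p : ok e -> on_curve (cur e) p -> [\/ p = pos e.1, p = pos e.2 |
    adj e.1 e.2 /\ exists2 t, (0 < t < 1)%Re & p = arc e.1 e.2 t].
  rewrite /ok /cur => + [t t01 ->]; case: eqVneq => [_ _ | _ /= xy]; first by constructor 1.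
  have [_ [a0 [a1 _]]] := arcP _ _ xy.
  have [-> | nt0] := Req_EM_T t 0; first by constructor 1.
  have [-> | nt1] := Req_EM_T t 1; first by constructor 2.
  by constructor 3; split=> //; exists t => //; lra.
pose apart (e e' : V * V) := [&& e.1 != e'.1, e.1 != e'.2, e.2 != e'.1 & e.2 != e'.2].
have cur_disj e e' p : ok e -> ok e' -> apart e e' ->
    on_curve (cur e) p -> ~ on_curve (cur e') p.
  move=> oke oke' /and4P[n11 n12 n21 n22] pe pe'.
  have nP x y : x != y -> pos x <> pos y by move=> /eqP xy /posI.
  have aP x y t z : adj x y -> (0 < t < 1)%Re -> arc x y t <> pos z.
    by move=> xy t01; have [_ [_ [_ [_ H]]]] := arcP _ _ xy; apply: H.
  move: (cur_cases _ _ oke' pe').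
  case: (cur_cases _ _ oke pe) => [-> | -> | [a [t t01 ->]]] [| | [a' [t' t'01]]];
    try exact: nP; try exact: aP; try by move=> /esym; apply: aP.
  (* Were the unordered edges equal, [e.1] would be an endpoint of [e']. *)
  apply: arcD => //; apply: contraNneq n11 => S.
  by have := set21 e.1 e.2; rewrite S !inE (negPf n12) orbF.
have [d d0 sep] : exists2 d, (0 < d)%Re & forall ee : (V * V) * (V * V),
    ok ee.1 -> ok ee.2 -> apart ee.1 ee.2 ->
    forall p q, on_curve (cur ee.1) p -> on_curve (cur ee.2) q -> far d p q.
  apply: finite_uniform => [ee d d' dd' H ok1 ok2 ap p q p1 q2 | [e e'] /=].
    by have := H ok1 ok2 ap p q p1 q2; rewrite /far; lra.
  (* Pairs that fail a hypothesis satisfy the bound vacuously, with the arbitrary value 1. *)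
  case oke: (ok e); last by exists 1%Re => //; lra.
  case oke': (ok e'); last by exists 1%Re => //; lra.
  case ap: (apart e e'); last by exists 1%Re => //; lra.
  have [c _ _] := curP _ oke; have [c' _ _] := curP _ oke'.
  have [d d0 H] := curves_separated c c' (fun p => cur_disj e e' p oke oke' ap).
  by exists d.
(* The rectangle argument needs a separation of ten times the sampling step. *)
have d0' : (0 < d / 10)%Re by lra.
pose K (D : pred V) p := exists e : V * V, [/\ D e.1, D e.2, ok e & on_curve (cur e) p].
have walk (D : pred V) x y : D x -> connect (within adj D) x y ->
    exists2 l, trail (K D) (d / 10) (pos x) l & last (pos x) l = pos y.
  move=> Dx /connectP[s + ->]; elim: s x Dx => [|z s IH] x Dx /=.
    move=> _; exists [::] => //; apply: TrailNil; exists (x, x).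
    by rewrite /ok /cur eqxx; split=> //; exists 0%Re => //; lra.
  case/andP=> /and3P[xz _ Dz] /(IH z Dz)[l T L].
  have okxz : ok (x, z) by rewrite /ok xz orbT.
  have [c c0 c1] := curP _ okxz; have [l' T' L'] := curve_trail d0' c.
  rewrite c0 c1 /= in T' L'.
  exists (l' ++ l); last by rewrite last_cat L'.
  apply: trail_cat; last by rewrite L'.
  by apply: trail_sub T' => p pc; exists (x, z).
have /functional_choice[l lP] : forall f, exists l, f \in E ->
    trail (K (C f)) (d / 10) (pos (psi f.1)) l /\ last (pos (psi f.1)) l = pos (psi f.2).
  move=> f; case fE: (f \in E); last by exists [::].
  by have [Cf /(walk _ _ _ Cf)[l T L]] := conn _ fE; exists l.
have farP f g p q : f \in E -> g \in E -> disjoint_edges f g ->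
    K (C f) p -> K (C g) q -> far (10 * (d / 10)) p q.
  move=> fE gE fg [e [e1 e2 oke pe]] [e' [e1' e2' oke' qe']].
  rewrite (_ : 10 * (d / 10) = d)%Re; last by lra.
  apply: (sep (e, e')) => //=.
  by apply/and4P; split; apply/eqP => eq; have := disjC _ _ _ fE gE fg;
    [move/(_ _ e1); rewrite eq e1' | move/(_ _ e1); rewrite eq e2'
    |move/(_ _ e2); rewrite eq e1' | move/(_ _ e2); rewrite eq e2'].
apply: (obsE (fun v f => crossings (pos (psi v)) (pos (psi f.1)) (l f))
             (fun a b => upper (vsub (pos (psi a)) (pos (psi b))))).
  move=> f g fE gE fg.
  have [Tf Lf] := lP _ fE; have [Tg Lg] := lP _ gE.
  have F p q := farP f g p q fE gE fg.
  have := crossings_rectangle d0' F Tf Tg.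
  (* The two sides along [g] become parities seen from the ends of [f], at the cost of the four
     [upper] terms. *)
  rewrite (rev_crossingsE d0' F (trail_head Tf) Tg) (rev_crossingsE d0' F (trail_last Tf) Tg).
  by rewrite Lf Lg; case_bools.
move=> f g x y fE gE fg xf yg.
have [Tf Lf] := lP _ fE; have [Tg Lg] := lP _ gE.
apply: (@upper_vsubC (10 * (d / 10))); first lra.
apply: farP fg _ _ => //.
  by case/orP: xf => /eqP->; rewrite -?Lf; [apply: trail_head Tf | apply: trail_last Tf].
by case/orP: yg => /eqP->; rewrite -?Lg; [apply: trail_head Tg | apply: trail_last Tg].
Qed.

(** * Walks in token graphs *)

Lemma card_move (T : finType) (A : {set T}) (u v : T) :
  u \in A -> v \notin A -> #|v |: A :\ u| = #|A|.
Proof.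
move=> uA vA; rewrite cardsU1 !inE (negPf vA) andbF /= [#|A|](cardsD1 u) uA.
by [].
Qed.

Lemma token_of_set (T : finType) (k : nat) (A : {set T}) :
  #|A| == k -> exists B : token T k, val B = A.
Proof. by move=> Ak; exists (exist _ A Ak). Qed.

Lemma token_adj_sym (T : finType) (e : rel T) (k : nat) : symmetric (@token_adj T e k).
Proof. by move=> A B; rewrite /token_adj setUC. Qed.

Lemma token_adj_move (T : finType) (e : rel T) (k : nat) (A B : token T k) (a b : T) :
  e a b -> a \in val A -> b \notin val A -> val B = b |: val A :\ a -> token_adj e A B.
Proof.
move=> ab aA bA eqB; apply/existsP; exists a; apply/existsP; exists b.
rewrite ab /=; apply/eqP/setP => x; rewrite eqB !inE.
have [-> | xa] := eqVneq x a.
  by rewrite aA /=; have -> : (a == b) = false by apply: contraNF bA => /eqP<-.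
by have [-> | xb] := eqVneq x b; [rewrite bA | case: (x \in val A)].
Qed.

Lemma within_connect_sym (V : finType) (adj : rel V) (C : pred V) :
  symmetric adj -> connect_sym (within adj C).
Proof.
by move=> sym; apply: sym_connect_sym => x y; rewrite /within /= sym [C x && _]andbC.
Qed.

(* A token standing on [u] is exchanged with the hole at the end of the path:
   if the next vertex is free the token advances first, otherwise the token on
   the next vertex goes ahead. *)
Lemma token_move_path (T : finType) (e : rel T) (k : nat) (D : pred (token T k))
    (p : seq T) (u : T) (A B : token T k) :
  path e u p -> uniq (u :: p) -> u \in val A -> last u p \notin val A ->
  val B = last u p |: val A :\ u ->
  (forall X : token T k, (forall y, y \notin u :: p -> (y \in val X) = (y \in val A)) -> D X) ->
  connect (within (@token_adj T e k) D) A B.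
Proof.
elim: p u A B => [|y p IH] u A B; first by move=> _ _ /= ->.
move=> /andP[uy yp] /andP[u_yp yp_uniq] uA; rewrite last_cons => vA eqB inD.
have DA : D A by apply: inD.
have not_last z : z \notin y :: p -> (z == last y p) = false.
  by apply: contraNF => /eqP->; apply: mem_last.
have DB : D B.
  by apply: inD => z; rewrite eqB !inE negb_or => /andP[-> /not_last->].
have moved u' v' : u' \in val A -> v' \notin val A ->
    exists B : token T k, val B = v' |: val A :\ u'.
  by move=> uA' vA'; apply: token_of_set; rewrite card_move // (eqP (valP A)).
have uv : u != last y p by apply: contraNneq vA => <-.
have yu : y != u by move: u_yp; rewrite inE negb_or eq_sym => /andP[].
have [yA | yA] := boolP (y \in val A).
  have [A1 eA1] := moved _ _ yA vA.
  have AA1 : connect (within (@token_adj T e k) D) A A1.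
    apply: (IH y) => // X XA; apply: inD => z; rewrite inE negb_or => /andP[_].
    exact: XA.
  apply: (connect_trans AA1); apply: connect1; apply/and3P; split=> //.
    apply: (token_adj_move uy); rewrite eA1.
    - by rewrite !inE uA (eq_sym u y) yu orbT.
    - by rewrite !inE eqxx orbF; apply: contraNneq vA => <-.
    rewrite eqB; apply/setP => z; rewrite !inE.
    have [-> | zu] := eqVneq z u; first by rewrite (negPf uv) eq_sym (negPf yu).
    by have [-> | zy] := eqVneq z y; [rewrite yA orbT | ].
  apply: inD => z; rewrite eA1 !in_setU1 !in_setD1 in_cons negb_or => /andP[_ zyp].
  by rewrite (not_last _ zyp); case: eqP zyp => // ->; rewrite mem_head.
have [A1 eA1] := moved _ _ uA yA.
have AA1 : token_adj e A A1 by apply: (token_adj_move uy).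
have DA1 : D A1.
  by apply: inD => z; rewrite eA1 !inE !negb_or => /and3P[zu zy zp]; rewrite zu (negPf zy).
apply: (connect_trans (connect1 (y := A1) _)); first by apply/and3P.
have [p0 | pn0] := eqVneq p [::].
  by rewrite (_ : B = A1) ?connect0 //; apply: val_inj; rewrite eqB eA1 p0.
have vy : last y p != y.
  clear -yp_uniq pn0; case: p pn0 yp_uniq => //= z p _ /andP[yzp _].
  by apply: contraNneq yzp => <-; apply: mem_last.
apply: (IH y) => //; rewrite ?eA1.
- by rewrite !inE eqxx.
- by rewrite !inE (negPf vy) (negPf vA) andbF.
- rewrite eqB; apply/setP => z; rewrite !inE.
  by have [-> | zy] := eqVneq z y; rewrite ?(negPf yA) ?andbF ?orbF //.
move=> X XA; apply: inD => z; rewrite inE negb_or => /andP[zu zyp].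
by rewrite XA // !inE zu; move: zyp; rewrite inE negb_or => /andP[/negPf-> _].
Qed.

(** * Finite models and their lifting to token graphs *)

Definition linked (T : finType) (e : rel T) (xs : seq T) (x y : T) : Prop :=
  exists p, [/\ path e x p, last x p = y, uniq (x :: p) &
    forall z, z \in x :: p -> z \in xs -> z = x \/ z = y].

Definition conf (T : finType) (xs : seq T) (F : {set T}) (w : seq bool) : {set T} :=
  F :|: [set x in mask w xs].

Definition trace (T : finType) (xs : seq T) (X : {set T}) : seq bool :=
  [seq x \in X | x <- xs].

Definition moves (H : seq (nat * nat)) (w w' : seq bool) : bool :=
  has (fun ij => [&& nth false w ij.1, ~~ nth false w ij.2 &
    w' == set_nth false (set_nth false w ij.1 false) ij.2 true]) H.

Definition step (H : seq (nat * nat)) (w w' : seq bool) : bool :=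
  moves H w w' || moves H w' w.

(** Only positions unchanged by the step from [w] to [w'] are compared: they keep their value
    throughout a push along the linking path, whose two ends are left free. *)
Definition agrees (w w' v : seq bool) : bool :=
  all (fun i => (nth false w i == nth false w' i) ==> (nth false v i == nth false w i))
      (iota 0 (size w)).

Fixpoint touches (w : seq bool) (s : seq (seq bool)) (v : seq bool) : bool :=
  if s is w' :: s' then agrees w w' v || touches w' s' v else false.

Fixpoint words (n : nat) : seq (seq bool) :=
  if n is n'.+1 then [seq b :: w | b <- [:: false; true], w <- words n'] else [:: [::]].

Lemma mem_words w : w \in words (size w).
Proof.
elim: w => //= b w IH; rewrite cats0 mem_cat.
by apply/orP; case: b; [right | left]; apply: map_f.
Qed.

Section Model.

Variables (N j : nat) (H E : seq (nat * nat)).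
Variables (codes : seq (seq bool)) (W : seq (seq (seq bool))).

Definition code a := nth [::] codes a.
(* [W] lists the interior vertices of the walks, in the order of [E]. *)
Definition route f := rcons (nth [::] W (index f E)) (code f.2).

(** A certificate checked by computation. Words of every weight are tested, since a token inside a
    linking path is invisible to [trace]. *)
Definition model : bool :=
  all (fun f => path (step H) (code f.1) (route f) &&
         all (fun w => (size w == N) && (count id w == j)) (code f.1 :: route f)) E &&
  all (fun fg => disjoint_edges fg.1 fg.2 ==>
         all (fun v => touches (code fg.1.1) (route fg.1) v ==>
                    ~~ touches (code fg.2.1) (route fg.2) v) (words N))
      [seq (f, g) | f <- E, g <- E].

End Model.

Section Lift.

Variables (T : finType) (e : rel T) (k : nat) (x0 : T) (xs : seq T) (F : {set T}).
Variables (j : nat) (H : seq (nat * nat)).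
Hypothesis e_sym : symmetric e.
Hypothesis xs_uniq : uniq xs.
Hypothesis F_xs : forall x, x \in xs -> x \notin F.
Hypothesis F_card : #|F| + j = k.
Hypothesis H_linked : forall ij, ij \in H ->
  [/\ ij.1 < size xs, ij.2 < size xs & linked e xs (nth x0 xs ij.1) (nth x0 xs ij.2)].

Lemma mem_conf w x : (x \in conf xs F w) =
  (x \in F) || (x \in xs) && nth false w (index x xs).
Proof. by rewrite !inE in_mask. Qed.

Lemma nth_conf w i : i < size xs -> (nth x0 xs i \in conf xs F w) = nth false w i.
Proof.
by move=> iN; rewrite mem_conf (negPf (F_xs (mem_nth _ iN))) mem_nth // index_uniq.
Qed.

Definition valid w := (size w == size xs) && (count id w == j).

Lemma card_conf w : valid w -> #|conf xs F w| == k.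
Proof.
move=> /andP[/eqP szw /eqP cw]; rewrite /conf cardsU -F_card.
have -> : F :&: [set x in mask w xs] = set0.
  apply/setP => x; rewrite !inE in_mask //; apply/negP => /and3P[xF xxs _].
  by have := F_xs xxs; rewrite xF.
by rewrite cards0 subn0 cardsE (card_uniqP (mask_uniq _ _)) // size_mask // cw.
Qed.

Lemma connect_moves (D : pred (token T k)) (A B : token T k) w w' :
  valid w -> val A = conf xs F w -> val B = conf xs F w' -> moves H w w' ->
  (forall X : token T k, agrees w w' (trace xs (val X)) -> D X) ->
  connect (within (@token_adj T e k) D) A B.
Proof.
move=> /andP[/eqP szw _] eA eB /hasP[[a b] ab /= /and3P[wa wb /eqP ew']] inD.
have [/= aN bN [p [pp pl pu pxs]]] := H_linked ab.
have ba : b != a by apply: contraNneq wb => ->.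
apply: (token_move_path pp) => //; rewrite ?pl ?eA ?nth_conf //.
  rewrite eB; apply/setP => x.
  have := mem_conf w x; have := mem_conf w' x; rewrite !inE => -> ->.
  rewrite ew' !nth_set_nth /= !nth_set_nth /=.
  have [xxs | xxs] := boolP (x \in xs); last first.
    by rewrite !andFb !orbF; do 2 (case: eqP => [E | _]; first by rewrite E mem_nth in xxs).
  rewrite (negPf (F_xs xxs)) /= -(index_uniq x0 bN xs_uniq) -{2}(index_uniq x0 aN xs_uniq).
  have idx i : i < size xs -> (index x xs == i) = (x == nth x0 xs i).
    by move=> iN; apply/eqP/eqP => [<- | ->]; [rewrite nth_index | rewrite index_uniq].
  rewrite !index_uniq // !idx //; case: eqP => //= _; by case: eqP.
move=> X XA; apply: inD; apply/allP => i; rewrite mem_iota add0n szw => /andP[_ iN].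
apply/implyP => /eqP ww'; rewrite /trace (nth_map x0) // XA ?eA ?nth_conf //.
(* The path meets [xs] only at its ends, and both of these change value in the move. *)
apply/negP => /pxs[|E|E]; first exact: mem_nth.
  by move/eqP: E; rewrite nth_uniq // => /eqP E; move: ww'; rewrite ew' E
    !nth_set_nth /= eq_sym (negPf ba) nth_set_nth /= eqxx wa.
by move/eqP: E; rewrite nth_uniq // => /eqP E; move: ww'; rewrite ew' E
    !nth_set_nth /= eqxx (negPf wb).
Qed.

Lemma trace_conf w : size w = size xs -> trace xs (conf xs F w) = w.
Proof.
move=> szw; apply: (@eq_from_nth _ false); rewrite size_map // => i iN.
by rewrite (nth_map x0) // nth_conf.
Qed.

Lemma agreesC w w' v : size w = size w' -> agrees w w' v = agrees w' w v.
Proof.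
by move=> sz; rewrite /agrees sz; apply: eq_all => i; rewrite [in RHS]eq_sym; case: eqP => //= ->.
Qed.

Lemma connect_route (D : pred (token T k)) (tok : seq bool -> token T k) w s :
  (forall w', valid w' -> val (tok w') = conf xs F w') ->
  path (step H) w s -> all valid (w :: s) ->
  (forall X : token T k, touches w s (trace xs (val X)) -> D X) ->
  connect (within (@token_adj T e k) D) (tok w) (tok (last w s)).
Proof.
move=> tokP; elim: s w => [|w' s IH] w; first by rewrite connect0.
move=> /andP[ww' w's] /andP[vw vs] inD.
have vw' : valid w' by case/andP: vs.
have sz : size w = size w' by move: vw vw' => /andP[/eqP-> _] /andP[/eqP-> _].
apply: (connect_trans (y := tok w')); last first.
  by apply: IH => // X Xs; apply: inD; rewrite /= Xs orbT.
case/orP: ww' => mv.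
  by apply: (connect_moves vw (tokP _ vw) (tokP _ vw') mv) => X a; apply: inD; rewrite /= a.
rewrite (within_connect_sym _ (@token_adj_sym T e k)).
apply: (connect_moves vw' (tokP _ vw') (tokP _ vw) mv) => X a; apply: inD.
by rewrite /= agreesC ?a.
Qed.

Lemma nonplanar_of_model E codes W : obstructed E -> model (size xs) j H E codes W ->
  ~ planar (@token_adj T e k).
Proof.
move=> obsE /andP[/allP routes /allP disj] pl.
have validE f w : f \in E -> w \in code codes f.1 :: route E codes W f -> valid w.
  by move=> fE; case/andP: (routes _ fE) => _ /allP; apply.
have [A0 _] : exists A : token T k, True.
  case: E obsE validE {routes disj} => [obs0 _ | f E _ validE].
    (* An empty edge list obstructs nothing, so some edge supplies a default token set for the
       invalid words. *)
    by case: (obs0 (fun _ _ => false) (fun _ _ => false)).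
  have vf := validE f _ (mem_head _ _) (mem_head _ _).
  by have [A _] := token_of_set (card_conf vf); exists A.
have /functional_choice[tok tokP] : forall w, exists A : token T k, valid w -> val A = conf xs F w.
  move=> w; case vw: (valid w); last by exists A0.
  by have [A eA] := token_of_set (card_conf vw); exists A.
pose C f : pred (token T k) :=
  fun X => touches (code codes f.1) (route E codes W f) (trace xs (val X)).
apply: (@planar_regions _ _ E (fun a => tok (code codes a)) C pl obsE) => [f fE | f g X fE gE fg].
  have vf := validE f _ fE (mem_head _ _); have szf : size (code codes f.1) = size xs.
    by case/andP: vf => /eqP.
  split.
    rewrite /C tokP // trace_conf // /route.
    have refl w : agrees (code codes f.1) w (code codes f.1).
      by apply/allP => i _; rewrite eqxx implybT.
    (* A route is never empty, so its first step already places the starting configuration in the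
       region. *)
    by case: (nth _ _ _) => [|w s] /=; rewrite refl.
  have := @connect_route (C f) tok (code codes f.1) (route E codes W f) tokP.
  rewrite last_rcons; apply=> //; first by case/andP: (routes _ fE).
  by apply/allP => w; apply: validE.
have := disj (f, g); rewrite allpairs_f // => /(_ isT) /=; rewrite fg /= => /allP.
move=> /(_ (trace xs (val X))).
have -> : trace xs (val X) \in words (size xs).
  by rewrite -[X in words X](size_map (fun x => x \in val X)) mem_words.
by move=> /(_ isT)/implyP.
Qed.

End Lift.

(** * Explicit models on the star and the pentagon *)

Definition word (n : nat) (s : seq nat) : seq bool := [seq i \in s | i <- iota 0 n].

Definition star6 : seq (nat * nat) := [:: (0,1); (0,2); (0,3); (0,4); (0,5)].

Definition cycle5 : seq (nat * nat) := [:: (0,1); (1,2); (2,3); (3,4); (4,0)].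

(* The 2-token graph of the star is the subdivision of K5 whose branch vertices
   are the pairs containing the centre. *)
Definition star6_codes2 := map (word 6) [:: [:: 0;1]; [:: 0;2]; [:: 0;3]; [:: 0;4]; [:: 0;5]].

Definition star6_routes2 := map (map (word 6))
  [:: [:: [:: 1;2]]; [:: [:: 1;3]]; [:: [:: 1;4]]; [:: [:: 1;5]]; [:: [:: 2;3]];
      [:: [:: 2;4]]; [:: [:: 2;5]]; [:: [:: 3;4]]; [:: [:: 3;5]]; [:: [:: 4;5]]].

(* Needed only for six vertices and three tokens: a K33 in the Desargues graph. *)
Definition star6_codes3 := map (word 6)
  [:: [:: 0;1;3]; [:: 0;1;4]; [:: 0;1;5]; [:: 0;1;2]; [:: 0;2;3]; [:: 0;3;4]].

Definition star6_routes3 := map (map (word 6))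
  [:: [:: [:: 1;2;3]]; [:: [:: 1;2;3]]; [:: [:: 1;3;4]];
      [:: [:: 1;2;4]]; [:: [:: 1;2;4]; [:: 0;2;4]; [:: 2;3;4]]; [:: [:: 1;3;4]];
      [:: [:: 1;2;5]]; [:: [:: 1;2;5]; [:: 0;2;5]; [:: 2;3;5]];
      [:: [:: 1;3;5]; [:: 0;3;5]; [:: 3;4;5]]].

(* Two diagonals of the pentagon are adjacent in its 2-token graph or have a
   side as a common neighbour. *)
Definition cycle5_codes := map (word 5) [:: [:: 0;2]; [:: 1;3]; [:: 2;4]; [:: 0;3]; [:: 1;4]].

Definition cycle5_routes := map (map (word 5))
  [:: [:: [:: 1;2]]; [::]; [::]; [:: [:: 0;1]]; [:: [:: 2;3]];
      [::]; [::]; [:: [:: 3;4]]; [::]; [:: [:: 0;4]]].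

Lemma star6_model2 : model 6 2 star6 K5 star6_codes2 star6_routes2.
Proof. by vm_compute. Qed.

Lemma star6_model3 : model 6 3 star6 K33 star6_codes3 star6_routes3.
Proof. by vm_compute. Qed.

(** Exchanging tokens and holes reverses every move, which [step] allows, and preserves the
    disjointness of regions. *)
Lemma star6_model4 : model 6 4 star6 K5
  (map (map negb) star6_codes2) (map (map (map negb)) star6_routes2).
Proof. by vm_compute. Qed.

Lemma cycle5_model2 : model 5 2 cycle5 K5 cycle5_codes cycle5_routes.
Proof. by vm_compute. Qed.

Lemma cycle5_model3 : model 5 3 cycle5 K5
  (map (map negb) cycle5_codes) (map (map (map negb)) cycle5_routes).
Proof. by vm_compute. Qed.

(** * Large degree and long cycles *)

Lemma subset_of_card (T : finType) (U : {set T}) (m : nat) : m <= #|U| ->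
  exists2 F : {set T}, F \subset U & #|F| = m.
Proof.
move=> mU; exists [set x in take m (enum U)].
  by apply/subsetP => x; rewrite inE => /mem_take; rewrite mem_enum.
by rewrite cardsE (card_uniqP (take_uniq _ (enum_uniq _))) size_takel // -cardE.
Qed.

(** The other [k - j] tokens are placed outside [xs]; the last inequality says that there is room
    for them. *)
Lemma nonplanar_of_linked (T : finType) (e : rel T) (k j : nat) (x0 : T) (xs : seq T) H E codes W :
  symmetric e -> uniq xs -> obstructed E -> model (size xs) j H E codes W ->
  (forall ij, ij \in H -> [/\ ij.1 < size xs, ij.2 < size xs &
     linked e xs (nth x0 xs ij.1) (nth x0 xs ij.2)]) ->
  j <= k -> k + size xs <= #|T| + j -> ~ planar (@token_adj T e k).
Proof.
move=> e_sym xs_uniq obsE modelE Hl jk kT.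
have cU : #|~: [set x in xs]| = #|T| - size xs.
  by rewrite cardsCs setCK cardsE (card_uniqP xs_uniq).
have [F FU Fc] : exists2 F : {set T}, F \subset ~: [set x in xs] & #|F| = k - j.
  have sT : size xs <= #|T| by rewrite -(card_uniqP xs_uniq) max_card.
  apply: subset_of_card; rewrite cU leq_subLR addnBA // leq_subRL; last first.
    by rewrite (leq_trans sT) ?leq_addl.
  by rewrite addnC (addnC j).
apply: (@nonplanar_of_model T e k x0 xs F j H) modelE => //; last by rewrite Fc subnK.
by move=> x xxs; apply: contraL xxs => /(subsetP FU); rewrite !inE.
Qed.

Lemma linked_edge (T : finType) (e : rel T) (xs : seq T) (x y : T) :
  irreflexive e -> e x y -> linked e xs x y.
Proof.
move=> irr xy; exists [:: y]; split; rewrite //= ?xy ?andbT //.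
  by rewrite inE; apply: contraTneq xy => ->; rewrite irr.
by move=> z; rewrite !inE => /orP[] /eqP ->; [left | right].
Qed.

Lemma nonplanar_maxdeg (T : finType) (e : rel T) (k : nat) :
  simple_graph e -> 2 <= k -> k + 2 <= #|T| -> maxdeg_ge e 5 ->
  ~ planar (@token_adj T e k).
Proof.
move=> [e_sym e_irr] k2 kT [v v5].
set nb := [set w | e v w] in v5; pose s := take 5 (enum nb).
have szs : size s = 5 by rewrite size_takel // -cardE.
have sv w : w \in s -> e v w by move=> /mem_take; rewrite mem_enum inE.
have xs_uniq : uniq (v :: s).
  rewrite /= take_uniq ?enum_uniq // andbT.
  by apply/negP => /sv; rewrite e_irr.
have szxs : size (v :: s) = 6 by rewrite /= szs.
have Hl ij : ij \in star6 -> [/\ ij.1 < size (v :: s), ij.2 < size (v :: s)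
    & linked e (v :: s) (nth v (v :: s) ij.1) (nth v (v :: s) ij.2)].
  move=> ijH; have [i [-> i5]] : exists i, ij = (0, i.+1) /\ i < 5.
    by move: ijH; rewrite !inE => /or4P[|||/orP[]] /eqP->; eexists.
  rewrite szxs; split=> //; apply: linked_edge => //=.
  by apply: sv; rewrite mem_nth ?szs.
have nonplanar j E codes W := @nonplanar_of_linked T e k j v (v :: s) star6 E codes W e_sym xs_uniq.
(* Using [j] tokens on six vertices needs [6 - j] holes there: [j = 2] works with four holes in all,
   [j = 4] with two, and only [k = 3] on six vertices remains. *)
have [k4 | k4] := leqP (k + 4) #|T|.
  by apply: (nonplanar 2 K5 _ _ obstructed_K5 _ Hl); rewrite ?szxs;
    [exact: star6_model2 | | rewrite addnS addnS addn2 !ltnS].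
have [k5 | k5] := leqP 4 k.
  apply: (nonplanar 4 K5 _ _ obstructed_K5 _ Hl); rewrite ?szxs;
    [exact: star6_model4 | by [] | ].
  by rewrite (addnA k 2 4) leq_add2r.
have T6 : 6 <= #|T| by rewrite -szxs -(card_uniqP xs_uniq) max_card.
have k3 : k = 3.
  by apply/eqP; rewrite eqn_leq -ltnS k5 -(ltn_add2r 4) (leq_ltn_trans T6 k4).
apply: (nonplanar 3 K33 _ _ obstructed_K33 _ Hl); rewrite ?szxs ?k3 //.
  exact: star6_model3.
by rewrite addnC leq_add2r.
Qed.

Lemma nonplanar_circumference (T : finType) (e : rel T) (k : nat) :
  simple_graph e -> 2 <= k -> k + 2 <= #|T| -> circumference_ge e 5 ->
  ~ planar (@token_adj T e k).
Proof.
move=> [e_sym e_irr] k2 kT [[|x0 [|x1 [|x2 [|x3 [|x4 b]]]]] [] //].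
set xs := [:: x0; x1; x2; x3; x4]; rewrite -[_ :: _]/(xs ++ b) cat_uniq.
move=> /and3P[xs_uniq b_xs b_uniq] _.
rewrite /= => /and5P[e01 e12 e23 e34 e40].
have Hl ij : ij \in cycle5 -> [/\ ij.1 < size xs, ij.2 < size xs
    & linked e xs (nth x0 xs ij.1) (nth x0 xs ij.2)].
  rewrite !inE => /or4P[|||/orP[]] /eqP-> /=; split=> //; try exact: linked_edge.
  (* The pair [(4,0)] is linked by the rest of the cycle, from [x4] through [b] back to [x0]. *)
  exists (rcons b x0); split=> //; first by rewrite last_rcons.
    have b_x x : x \in xs -> x \notin b.
      by move=> xxs; apply: contraNN b_xs => xb; apply/hasP; exists x.
    rewrite cons_uniq mem_rcons rcons_uniq b_uniq inE negb_or !b_x ?inE ?eqxx ?orbT //=.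
    by rewrite !andbT; apply: contraTneq xs_uniq => eq40; rewrite /xs eq40 /= !inE eqxx !orbT.
  move=> z; rewrite inE mem_rcons inE => /or3P[/eqP-> | /eqP-> | zb] zxs; [by left | by right |].
  by case/hasP: b_xs; exists z.
have nonplanar j E codes W := @nonplanar_of_linked T e k j x0 xs cycle5 E codes W e_sym xs_uniq.
(* With three holes, two tokens are used on the pentagon; otherwise there are exactly two holes,
   hence at least three tokens. *)
have [k3 | k3] := leqP (k + 3) #|T|.
  apply: (nonplanar 2 K5 _ _ obstructed_K5 _ Hl); [exact: cycle5_model2 | by [] |].
  by rewrite (addnA k 3 2) leq_add2r.
have T5 : 5 <= #|T| by rewrite -[5]/(size xs) -(card_uniqP xs_uniq) max_card.
apply: (nonplanar 3 K5 _ _ obstructed_K5 _ Hl); [exact: cycle5_model3 | |].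
  by rewrite -(ltn_add2r 3) (leq_ltn_trans T5 k3).
by rewrite (addnA k 2 3) leq_add2r.
Qed.

Theorem theorem6 (T : finType) (e : rel T) (k : nat) :
  simple_graph e ->
  2 <= k -> k + 2 <= #|T| ->
  (maxdeg_ge e 5 \/ circumference_ge e 5) ->
  ~ planar (@token_adj T e k).
Proof.
by move=> simple k2 kT [d | c]; [apply: nonplanar_maxdeg | apply: nonplanar_circumference].
Qed.
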